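(* Let $n$ be a positive integer with $n \equiv 0 \pmod 4$, and let $C$ be a Type III code of length $n$. Then for every integer $k$ with $0<k\le \frac n2$, the number $L_k^{\mathrm{III}}(n)$ of Type III codes of length $n$ that are $k$-neighbors of $C$ is $$L_k^{\mathrm{III}}(n)=\frac{\prod_{i=0}^{k-1}\left(3^{\,n-1-i}-3^{\frac n2-1}\right)}{\prod_{j=0}^{k-1}\left(3^{\frac n2}-3^{\frac n2-1-j}\right)}.$$
   Context: Equip $\mathbb{F}_3^n$ with the inner product $u\cdot v=\sum_{i=1}^n u_iv_i$. A code of length $n$ over $\mathbb{F}_3$ is a linear subspace $C\subseteq\mathbb{F}_3^n$; its dual is $C^\perp=\{v\in\mathbb{F}_3^n : u\cdot v=0 \text{ for all } u\in C\}$, and $C$ is self-dual if $C=C^\perp$ (so $\dim C=n/2$). The weight of a vector is its number of nonzero coordinates. A Type III code is a self-dual code over $\mathbb{F}_3$ in which every codeword has weight divisible by $3$. For $0\le k\le n/2$, two self-dual codes $C,D$ of length $n$ are $k$-neighbors if $\dim(C\cap D)=\frac n2-k$. *)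

(* Defs.v *)
From HB Require Import structures.
From mathcomp Require Import all_boot all_order all_algebra.

Set Implicit Arguments.
Unset Strict Implicit.
Unset Printing Implicit Defensive.

Import GRing.Theory.
Local Open Scope ring_scope.

(* A {vspace vT} is a canonical matrix (a fixpoint of the genmx operator), so
   over a finite field there are finitely many of them and they can be
   counted. *)
Section FiniteVspace.
Import VectorInternalTheory.
Variables (K : finFieldType) (vT : vectType K).

HB.instance Definition _ := [Countable of {vspace vT} by <:].
HB.instance Definition _ := [Finite of {vspace vT} by <:].

End FiniteVspace.

Notation code n := {vspace 'rV['F_3]_n}.

Definition dotv (n : nat) (u v : 'rV['F_3]_n) : 'F_3 :=
  \sum_(i < n) u 0 i * v 0 i.

Fact dotv_is_linear n (u : 'rV['F_3]_n) :
  linear (dotv u : 'rV['F_3]_n -> ('F_3)^o).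
Proof.
move=> a v w; rewrite /dotv scaler_sumr -big_split /=.
by apply: eq_bigr => i _; rewrite !mxE mulrDr mulrCA.
Qed.

HB.instance Definition _ n (u : 'rV['F_3]_n) :=
  GRing.isLinear.Build 'F_3 'rV['F_3]_n ('F_3)^o *:%R (dotv u)
    (dotv_is_linear u).

Definition dual (n : nat) (C : code n) : code n :=
  (\bigcap_(u : 'rV['F_3]_n | u \in C)
     lker (linfun (dotv u : 'rV['F_3]_n -> ('F_3)^o)))%VS.

Lemma dualP n (C : code n) (v : 'rV['F_3]_n) :
  reflect (forall u, u \in C -> dotv u v = 0) (v \in dual C).
Proof.
rewrite /dual memvE; apply: (iffP subv_bigcapP) => vC u uC; last first.
  by rewrite -memvE memv_ker lfunE /= vC.
by have := vC u uC; rewrite -memvE memv_ker lfunE /= => /eqP.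
Qed.

Definition self_dual (n : nat) (C : code n) : bool := C == dual C.

Definition weight (n : nat) (v : 'rV['F_3]_n) : nat :=
  #|[set i : 'I_n | v 0 i != 0]|.

Definition type_III (n : nat) (C : code n) : bool :=
  self_dual C && [forall u : 'rV['F_3]_n in C, (3 %| weight u)%N].

(* Only meant for self-dual C and D, with k <= n./2: the subtraction is
   truncated. *)
Definition neighbors (n k : nat) (C D : code n) : bool :=
  \dim (C :&: D)%VS == (n./2 - k)%N.

Definition nb_type_III_neighbors (n k : nat) (C : code n) : nat :=
  #|[set D : code n | type_III D && neighbors k C D]|.

(* Main.v *)
Require Import Defs.
From mathcomp Require Import all_boot all_order all_algebra finfield.
From mathcomp Require Import ring zify.

Set Implicit Arguments.
Unset Strict Implicit.
Unset Printing Implicit Defensive.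

Import GRing.Theory Num.Theory.
Local Open Scope ring_scope.

(** Squares of nonzero elements of F_3 are 1, so the weight of [v] is [v.v]
    modulo 3 and the type III codes are exactly the self-dual ones. Put
    [m = \dim C = n/2], let [N_r] be the number of self-dual [D] with
    [\dim (C :&: D) = r], and recall that [k]-neighbors have [r = m - k].
    Since [N_m = 1], it suffices to relate [N_r] to [N_(r+1)].

    The relation comes from a construction of neighbors: for a self-dual [D]
    and an isotropic vector [x], the code [switch D x], namely
    [(D :&: x^perp) + <x>], is self-dual again ([switch_self_dual]). If [d] is
    a vector of [D] with [x.d <> 0], switching the result at [d] gives back
    [D] ([switchK]); and if [x] is in [C] but not in [D], then the
    intersection with [C] gains exactly the line of [x] ([dim_cap_switch]).
    So [(D, c, d) |-> (switch D c, c, d)] is a bijection ([card_switch])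
    - from the triples with [\dim (C :&: D) = r], [c] in [C], [d] in [D] and
      [c.d <> 0],
    - onto the triples [(E, c, d)] with [\dim (C :&: E) = r + 1],
      [c] in [C :&: E], [d] isotropic and [c.d <> 0].

    For a fixed [D], a vector [c] of [C] outside [D] is orthogonal to a third
    of [D], and a vector of [C :&: D] to all of it; this makes
    [(3^m - 3^r) * 2 * 3^(m-1)] pairs [(c, d)]. For a fixed [E], every nonzero
    [c] in [C :&: E] has [2 * 3^(n-2)] partners [d]: among the [2 * 3^(n-1)]
    vectors not orthogonal to [c], each line parallel to [c] carries exactly
    one isotropic vector ([card_isotropic_nonorth]). Equating the two counts
    gives [card_at_cap_dim_rec],
      [3 N_r (3^m - 3^r) = N_(r+1) 3^m (3^(r+1) - 1)],
    which for [r = m - k - 1] is the ratio of consecutive values of the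
    product formula. *)

(** * Orthogonality in F_3^n *)

Lemma dotvC n (u v : 'rV['F_3]_n) : dotv u v = dotv v u.
Proof. by apply: eq_bigr => i _; rewrite mulrC. Qed.

Lemma dotvDr n (u v w : 'rV['F_3]_n) : dotv u (v + w) = dotv u v + dotv u w.
Proof. exact: (linearD (dotv u)). Qed.

Lemma dotvZr n (a : 'F_3) (u v : 'rV['F_3]_n) : dotv u (a *: v) = a * dotv u v.
Proof. exact: (linearZ_LR (dotv u)). Qed.

Lemma dotv0r n (u : 'rV['F_3]_n) : dotv u 0 = 0.
Proof. exact: (linear0 (dotv u)). Qed.

Lemma dotvDl n (u v w : 'rV['F_3]_n) : dotv (v + w) u = dotv v u + dotv w u.
Proof. by rewrite !(dotvC _ u) dotvDr. Qed.

Lemma dotvZl n (a : 'F_3) (u v : 'rV['F_3]_n) : dotv (a *: v) u = a * dotv v u.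
Proof. by rewrite !(dotvC _ u) dotvZr. Qed.

Lemma weight_mod3 n (v : 'rV['F_3]_n) : (weight v)%:R = dotv v v.
Proof.
rewrite /weight /dotv -sum1_card natr_sum big_mkcond /=.
apply: eq_bigr => i _; rewrite inE.
by case: (v 0 i) => [[|[|[|//]]] lt3]; apply/eqP.
Qed.

Lemma self_dualP n (D : code n) (v : 'rV['F_3]_n) : self_dual D ->
  reflect (forall u, u \in D -> dotv u v = 0) (v \in D).
Proof. by move=> /eqP {2}->; exact: dualP. Qed.

Lemma self_dual_dot0 n (D : code n) (u v : 'rV['F_3]_n) :
  self_dual D -> u \in D -> v \in D -> dotv u v = 0.
Proof. by move=> sdD uD /(self_dualP _ sdD); apply. Qed.

Lemma type_IIIE n (D : code n) : type_III D = self_dual D.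
Proof.
rewrite /type_III; case sdD: (self_dual D) => //=.
apply/forall_inP => u uD.
have: (weight u)%:R == 0 :> 'F_3 by rewrite weight_mod3 (self_dual_dot0 sdD).
by rewrite -(dvdn_pcharf (pchar_Fp (isT : prime 3))).
Qed.

Definition orth n (x : 'rV['F_3]_n) : code n :=
  lker (linfun (dotv x : 'rV['F_3]_n -> ('F_3)^o)).

Lemma mem_orth n (x v : 'rV['F_3]_n) : (v \in orth x) = (dotv x v == 0).
Proof. by rewrite memv_ker lfunE. Qed.

Lemma card_code n (U : code n) : #|U| = (3 ^ \dim U)%N.
Proof. by rewrite card_vspace card_Fp. Qed.

(** * Counting orthogonal pairs *)

Lemma dimv_cap_orth n (U : code n) (x : 'rV['F_3]_n) :
  x \notin dual U -> (\dim (U :&: orth x)).+1 = \dim U.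
Proof.
pose f := linfun (dotv x : 'rV['F_3]_n -> ('F_3)^o).
move=> xU; rewrite -(limg_ker_dim f U).
rewrite -[in LHS]addn1; congr (_ + _)%N; apply/esym/eqP.
rewrite eqn_leq (leq_trans (dimvS (subvf _))) ?dimvf //= lt0n dimv_eq0.
apply: contra xU => /eqP img0; apply/dualP => u uU.
by have := memv_img f uU; rewrite img0 memv0 lfunE /= dotvC => /eqP.
Qed.

(** The vectors of [U] orthogonal to [x] are all of [U] or a hyperplane, hence
    a third, of it. The factor 3 on the left keeps the count in [nat] without
    dividing. *)
Lemma card_nonorth n (U : code n) (x : 'rV['F_3]_n) :
  (3 * #|[set u in U | dotv x u != 0%R]| = (x \notin dual U) * (2 * #|U|))%N.
Proof.
case: (boolP (x \in dual U)) => [/dualP xU|xU].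
  rewrite mul0n; apply/eqP; rewrite muln_eq0 /= cards_eq0; apply/eqP/setP => u.
  by rewrite !inE; case uU: (u \in U) => //=; rewrite dotvC xU ?eqxx.
have := cardsID [set v in orth x] [set u in U].
have -> : [set u in U] :\: [set v in orth x] = [set u in U | dotv x u != 0%R].
  by apply/setP => u; rewrite !inE mem_orth andbC.
have -> : [set u in U] :&: [set v in orth x] = [set v in (U :&: orth x)%VS].
  by apply/setP => u; rewrite !inE memv_cap.
rewrite !cardsE !card_code -(dimv_cap_orth xU) expnS; lia.
Qed.

Lemma card_sum2 (T1 T2 : finType) (A : {pred T1}) (P : T1 -> {pred T2}) :
  #|[set p : T1 * T2 | (p.1 \in A) && P p.1 p.2]| =
  (\sum_(a in A) #|[set b | P a b]|)%N.
Proof.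
rewrite -sum1dep_card.
under [RHS]eq_bigr => a _ do rewrite -sum1dep_card.
by rewrite pair_big_dep.
Qed.

Definition nonorth_pairs n (U W : code n) : {set 'rV['F_3]_n * 'rV['F_3]_n} :=
  [set p | (p.1 \in U) && ((p.2 \in W) && (dotv p.1 p.2 != 0))].

Lemma card_nonorth_pairs n (U W : code n) :
  (3 * #|nonorth_pairs U W| = 2 * #|W| * (#|U| - #|(U :&: dual W)%VS|))%N.
Proof.
rewrite /nonorth_pairs.
rewrite (card_sum2 (mem U) (fun u w => (w \in W) && (dotv u w != 0))).
rewrite big_distrr /= (eq_bigr _ (fun u _ => card_nonorth W u)).
rewrite -big_distrl /= mulnC; congr (_ * _)%N.
have := cardsID [set v in dual W] [set u in U].
rewrite -[#|U|]cardsE.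
have -> : [set u in U] :&: [set v in dual W] = [set v in (U :&: dual W)%VS].
  by apply/setP => u; rewrite !inE memv_cap.
rewrite [#|[set v in (U :&: _)%VS]|]cardsE => <-; rewrite addKn -sum1_card.
rewrite [RHS](eq_bigl (fun u => (u \in U) && (u \notin dual W))); last first.
  by move=> u; rewrite !inE andbC.
by rewrite big_mkcondr; apply: eq_bigr => u _; case: (u \notin _).
Qed.

Lemma dual_fullv n : dual {: 'rV['F_3]_n}%VS = 0%VS.
Proof.
apply/eqP; rewrite -subv0; apply/subvP => v /dualP vV; rewrite memv0.
apply/eqP/rowP => i; rewrite mxE -(vV (delta_mx 0 i) (memvf _)) /dotv.
rewrite (bigD1 i) //= big1 ?addr0 => [|j ji]; rewrite mxE ?eqxx ?mul1r //=.
by rewrite (negbTE ji) mul0r.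
Qed.

(** Counting the non-orthogonal pairs between [U] and the whole space from
    either side gives [|U| (3^n - |dual U|) = 3^n (|U| - 1)]. *)
Lemma card_dual n (U : code n) : (#|U| * #|dual U| = 3 ^ n)%N.
Proof.
have cardV : #|{: 'rV['F_3]_n}%VS| = (3 ^ n)%N.
  by rewrite card_code dimvf dim_matrix mul1r.
have swap : #|nonorth_pairs U {:_}%VS| = #|nonorth_pairs {:_}%VS U|.
  pose sw (p : 'rV['F_3]_n * 'rV['F_3]_n) := (p.2, p.1).
  have sw_inj : injective sw by move=> [? ?] [? ?] [-> ->].
  rewrite -(card_imset _ sw_inj); apply: eq_card => -[v u].
  apply/imsetP/idP => [[[u' v'] + [-> ->]]|].
    by rewrite !inE /= memvf dotvC => /and3P[-> _ ->].
  rewrite !inE /= => /and3P[_ ? ?]; exists (u, v) => //.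
  by rewrite !inE memvf dotvC; apply/and3P.
have := card_nonorth_pairs U {:_}%VS; have := card_nonorth_pairs {:_}%VS U.
rewrite swap => ->; rewrite dual_fullv capv0 capfv cardV.
have -> : #|(0%VS : code n)| = 1%N by rewrite card_code dimv0.
have : (#|dual U| <= 3 ^ n)%N.
  by rewrite -cardV subset_leq_card //; apply/subsetP => v; rewrite memvf.
have : (0 < #|U|)%N by rewrite card_code expn_gt0.
move: #|U| #|dual U| (3 ^ n)%N => u d N *; nia.
Qed.

Lemma dim_self_dual n (D : code n) : self_dual D -> (2 * \dim D = n)%N.
Proof.
move=> /eqP sdD; have := card_dual D.
rewrite -sdD card_code -expnD addnn -mul2n.
by move/expnI; apply.
Qed.

Lemma eq_dim_self_dual n (C D : code n) :
  self_dual C -> self_dual D -> \dim C = \dim D.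
Proof. by move=> /dim_self_dual dimC /dim_self_dual dimD; lia. Qed.

(** * Switching a self-dual code at an isotropic vector *)

Definition switch n (D : code n) (x : 'rV['F_3]_n) : code n :=
  (D :&: orth x + <[x]>)%VS.

Lemma switchP n (D : code n) (x v : 'rV['F_3]_n) :
  reflect (exists u a, [/\ u \in D, dotv x u = 0 & v = u + a *: x])
          (v \in switch D x).
Proof.
apply: (iffP memv_addP) => [[u + [w /vlineP[a ->] ->]]|[u [a [uD xu ->]]]].
  by rewrite memv_cap mem_orth => /andP[uD /eqP xu]; exists u, a.
exists u; first by rewrite memv_cap uD mem_orth xu /=.
by exists (a *: x) => //; apply/vlineP; exists a.
Qed.

Lemma mem_switch n (D : code n) (x : 'rV['F_3]_n) : x \in switch D x.
Proof.
by apply/switchP; exists 0, 1; rewrite mem0v dotv0r add0r scale1r.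
Qed.

(** For [w] orthogonal to [switch D x], subtract from [w] the multiple of [x]
    that makes it orthogonal to [d]. The difference is orthogonal to the
    hyperplane [D :&: orth x] and to [d], which together span [D], so it lies
    in [D]; it is also orthogonal to [x], hence lies in [D :&: orth x]. *)
Lemma switch_self_dual n (D : code n) (x d : 'rV['F_3]_n) :
  self_dual D -> dotv x x = 0 -> d \in D -> dotv x d != 0 ->
  self_dual (switch D x).
Proof.
move=> sdD xx dD xd; rewrite /self_dual eqEsubv; apply/andP; split.
  apply/subvP => v /switchP[u [a [uD xu ->]]]; apply/dualP.
  move=> _ /switchP[w [b [wD xw ->]]].
  rewrite !(dotvDl, dotvDr, dotvZl, dotvZr) (self_dual_dot0 sdD) // xx xu.
  by rewrite (dotvC w) xw !(mulr0, addr0).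
apply/subvP => w /dualP w_orth; apply/switchP.
pose a := dotv d w / dotv x d.
have xD := mem_switch D x.
exists (w - a *: x), a; rewrite subrK; split=> //; last first.
  by rewrite -scaleNr dotvDr dotvZr xx mulr0 addr0 w_orth.
apply/(self_dualP _ sdD) => u uD; pose b := dotv x u / dotv x d.
have : u - b *: d \in switch D x.
  apply/switchP; exists (u - b *: d), 0; rewrite scale0r addr0; split=> //.
    by rewrite rpredB // rpredZ.
  by rewrite -scaleNr dotvDr dotvZr mulNr divfK ?subrr.
move/w_orth; rewrite -!scaleNr dotvDl dotvZl dotvDr dotvZr.
rewrite (dotvC u x) (dotvC d) /a /b (dotvC d) => /eqP.
rewrite mulNr subr_eq0 => /eqP ->.
apply/eqP; rewrite mulNr subr_eq0; apply/eqP; ring.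
Qed.

(** Since [x.d <> 0] and [D] is isotropic, the part of [switch D x] orthogonal
    to [d] is [D :&: orth x], and [d] completes this hyperplane to [D]. *)
Lemma switchK n (D : code n) (x d : 'rV['F_3]_n) :
  self_dual D -> d \in D -> dotv x d != 0 -> switch (switch D x) d = D.
Proof.
move=> sdD dD xd; apply/eqP; rewrite eqEsubv; apply/andP; split.
  apply/subvP => _ /switchP[_ [b [/switchP[u [a [uD xu ->]]] + ->]]].
  rewrite dotvDr (self_dual_dot0 sdD) // add0r dotvZr => /eqP.
  rewrite mulf_eq0 dotvC (negbTE xd) orbF => /eqP->.
  by rewrite scale0r addr0 rpredD // rpredZ.
apply/subvP => v vD; apply/switchP; pose b := dotv x v / dotv x d.
have vbD : v - b *: d \in D by rewrite rpredB // rpredZ.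
exists (v - b *: d), b; rewrite subrK (self_dual_dot0 sdD) //; split=> //.
apply/switchP; exists (v - b *: d), 0; rewrite scale0r addr0; split=> //.
by rewrite -scaleNr dotvDr dotvZr mulNr divfK ?subrr.
Qed.

(** A vector [u + a *: c] of [switch D c] is in [C] iff [u] is, because [c] is;
    and every vector of [C :&: D] is orthogonal to [c] because [C] is
    isotropic. *)
Lemma cap_switch n (C D : code n) (c : 'rV['F_3]_n) :
  self_dual C -> c \in C -> (C :&: switch D c = C :&: D + <[c]>)%VS.
Proof.
move=> sdC cC; apply/eqP; rewrite eqEsubv; apply/andP; split; apply/subvP => v.
  rewrite memv_cap => /andP[+ /switchP[u [a [uD _ vE]]]]; rewrite {}vE => uaC.
  rewrite memv_add ?memvZ ?memv_line // memv_cap uD andbT.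
  by rewrite -(addrK (a *: c) u) rpredB // rpredZ.
case/memv_addP => u + [_ /vlineP[a ->] ->]; rewrite !memv_cap => /andP[uC uD].
rewrite rpredD ?rpredZ //=; apply/switchP; exists u, a.
by rewrite (self_dual_dot0 sdC).
Qed.

Lemma dim_cap_switch n (C D : code n) (c : 'rV['F_3]_n) :
  self_dual C -> c \in C -> c \notin D ->
  \dim (C :&: switch D c) = (\dim (C :&: D)).+1.
Proof.
move=> sdC cC cD; rewrite cap_switch // dimv_disjoint_sum ?dim_vline.
  by rewrite addnC; case: eqP cD => // ->; rewrite mem0v.
apply/eqP; rewrite -subv0; apply/subvP => v; rewrite memv0 memv_cap.
case/andP => /[swap] /vlineP[a ->]; rewrite memv_cap => /andP[_ acD].
apply: contraNT cD; rewrite scaler_eq0 negb_or => /andP[a0 _].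
by rewrite -(scale1r c) -(mulVf a0) -scalerA rpredZ.
Qed.

(** * The two counts of triples *)

Lemma addF3 (x : 'F_3) : x + x + x = 0.
Proof. by case: x => [[|[|[|//]]] lt3]; apply/eqP. Qed.

(** If [c.v <> 0] then [(v - a *: c).(v - a *: c) = v.v - 2 a (c.v)] vanishes
    for exactly one [a]. So adding multiples of [c] to the vectors counted here
    yields each of the [2 * 3^(n-1)] vectors not orthogonal to [c] once. *)
Lemma card_isotropic_nonorth n (c : 'rV['F_3]_n) : c != 0 -> dotv c c = 0 ->
  (9 * #|[set d : 'rV['F_3]_n | (dotv d d == 0%R) && (dotv c d != 0%R)]|
   = 2 * 3 ^ n)%N.
Proof.
move=> c0 cc; set S := [set d | _].
pose f (p : 'rV['F_3]_n * 'F_3) := p.1 + p.2 *: c.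
have f_inj : {in setX S [set: 'F_3] &, injective f}.
  move=> [d a] [e b]; rewrite !inE !andbT /f /=.
  move=> /andP[/eqP dd cd] /andP[/eqP ee ce].
  move=> /(canRL (addrK _)); rewrite -addrA -scaleNr -scalerDl => dE.
  (* Both being isotropic forces 2 (b - a) (c.e) = 0. *)
  suff ab : b - a = 0.
    by rewrite dE ab scale0r addr0 -[b](subrK a) ab add0r.
  move: dd; rewrite dE !(dotvDl, dotvDr, dotvZl, dotvZr) ee cc (dotvC e).
  rewrite !(mulr0, addr0) add0r => ab2.
  have /eqP := addF3 ((b - a) * dotv c e).
  by rewrite ab2 add0r mulf_eq0 (negbTE ce) orbF => /eqP.
have imf :
    f @: setX S [set: 'F_3] = [set v in {:'rV['F_3]_n}%VS | dotv c v != 0].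
  apply/setP => v; rewrite !inE memvf /=; apply/imsetP/idP.
    move=> [[d a]]; rewrite !inE /= => /andP[/andP[_ cd] _] ->.
    by rewrite dotvDr dotvZr cc mulr0 addr0.
  (* This solves 2 a (c.v) = v.v, as 2 = -1 in F_3. *)
  move=> cv; pose a := - (dotv v v / dotv c v).
  exists (v - a *: c, a); last by rewrite /f /= subrK.
  rewrite !inE andbT -scaleNr !(dotvDl, dotvDr, dotvZl, dotvZr) cc (dotvC v c).
  by rewrite !(mulr0, addr0) cv andbT opprK divfK // addF3 eqxx.
have := card_nonorth {:'rV['F_3]_n}%VS c.
rewrite dual_fullv memv0 c0 mul1n card_code dimvf dim_matrix mul1r => <-.
by rewrite -imf card_in_imset // cardsX cardsT card_Fp //; lia.
Qed.

Definition at_cap_dim n (C : code n) (r : nat) : {set code n} :=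
  [set D | self_dual D && (\dim (C :&: D) == r)].

Definition isotropic_pairs n (U : code n) : {set 'rV['F_3]_n * 'rV['F_3]_n} :=
  [set p | (p.1 \in U) && ((dotv p.2 p.2 == 0) && (dotv p.1 p.2 != 0))].

Lemma card_isotropic_pairs n (C D : code n) : self_dual D ->
  (9 * #|isotropic_pairs (C :&: D)| =
   2 * 3 ^ n * (3 ^ \dim (C :&: D) - 1))%N.
Proof.
move=> sdD; rewrite /isotropic_pairs.
rewrite (card_sum2 (mem (C :&: D)%VS)
          (fun c d => (dotv d d == 0) && (dotv c d != 0))).
rewrite (bigD1 0) ?mem0v //= [X in (X + _)%N](_ : _ = 0%N); last first.
  apply/eqP; rewrite cards_eq0; apply/eqP/setP => d.
  by rewrite !inE dotvC dotv0r eqxx andbF.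
rewrite add0n big_distrr /=.
rewrite (eq_bigr (fun _ => 2 * 3 ^ n)%N); last first.
  move=> c /andP[]; rewrite memv_cap => /andP[_ cD] c0.
  by rewrite card_isotropic_nonorth // (self_dual_dot0 sdD).
rewrite sum_nat_const mulnC; congr (_ * _)%N.
rewrite -card_code (cardD1 0 (mem (C :&: D)%VS)) mem0v addKn.
by apply: eq_card => c; rewrite !inE andbC.
Qed.

(** Both sides count triples, which [(D, c, d) |-> (switch D c, c, d)] matches:
    the inverse is [(E, c, d) |-> (switch E d, c, d)], and it lands in the
    stated dimension because [E] is itself [switch (switch E d) c]. *)
Lemma card_switch n (C : code n) r : self_dual C ->
  (\sum_(D in at_cap_dim C r) #|nonorth_pairs C D| =
   \sum_(D in at_cap_dim C r.+1) #|isotropic_pairs (C :&: D)|)%N.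
Proof.
move=> sdC.
have sumE s (P : code n -> {set 'rV['F_3]_n * 'rV['F_3]_n}) :
    (\sum_(D in at_cap_dim C s) #|P D| =
     #|[set t : code n * _ | (t.1 \in at_cap_dim C s) && (t.2 \in P t.1)]|)%N.
  rewrite (card_sum2 (mem (at_cap_dim C s)) (fun D => mem (P D))).
  by apply: eq_bigr => D _; apply: eq_card => p; rewrite inE.
rewrite !sumE.
pose f (t : code n * ('rV['F_3]_n * 'rV['F_3]_n)) := (switch t.1 t.2.1, t.2).
rewrite -(card_in_imset (f := f)); last first.
  move=> [D [c d]] [E [c' d']]; rewrite !inE /= => /and4P[/andP[sdD _] _ dD cd].
  move=> /and4P[/andP[sdE _] _ dE cd'] fE.
  have /= [cE d'E] := congr1 snd fE; have /= DE := congr1 fst fE; subst c' d'.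
  by rewrite -(switchK sdD dD cd) DE (switchK sdE).
apply: eq_card => -[E [c d]]; apply/imsetP/idP.
  move=> [[D [c' d']]]; rewrite !inE /=.
  move=> /and4P[/andP[sdD /eqP dimD] c'C d'D cd].
  move=> fE; have /= [-> ->] := congr1 snd fE; have /= -> := congr1 fst fE.
  have cc := self_dual_dot0 sdC c'C c'C.
  rewrite (switch_self_dual sdD cc d'D cd) dim_cap_switch //; last first.
    by apply: contra cd => /(self_dual_dot0 sdD)/(_ d'D) ->.
  rewrite dimD eqxx memv_cap c'C cd (self_dual_dot0 sdD) // eqxx !andbT /=.
  exact: mem_switch.
rewrite !inE /= memv_cap.
move=> /and4P[/andP[sdE /eqP dimE] /andP[cC cE] /eqP dd cd].
have dc : dotv d c != 0 by rewrite dotvC.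
have sdD := switch_self_dual sdE dd cE dc.
have EK := switchK sdE cE dc.
have dD := mem_switch E d.
exists (switch E d, (c, d)); last by rewrite /f /= EK.
rewrite !inE sdD cC dD cd !andbT /= -eqSS -dimE.
rewrite -(dim_cap_switch (c := c)) ?EK //.
by apply: contra cd => /(self_dual_dot0 sdD)/(_ dD) ->.
Qed.

Lemma card_at_cap_dim_rec n (C : code n) r : self_dual C ->
  (3 * #|at_cap_dim C r| * (3 ^ \dim C - 3 ^ r) =
   #|at_cap_dim C r.+1| * 3 ^ \dim C * (3 ^ r.+1 - 1))%N.
Proof.
move=> sdC; have := card_switch r sdC.
have L : (3 * \sum_(D in at_cap_dim C r) #|nonorth_pairs C D| =
          #|at_cap_dim C r| * (2 * 3 ^ \dim C * (3 ^ \dim C - 3 ^ r)))%N.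
  rewrite big_distrr -sum_nat_const; apply: eq_bigr => D.
  rewrite inE => /andP[sdD /eqP dimD]; rewrite /= card_nonorth_pairs.
  by rewrite -(eqP sdD) !card_code dimD (eq_dim_self_dual sdD sdC).
have R : (9 * \sum_(D in at_cap_dim C r.+1) #|isotropic_pairs (C :&: D)| =
          #|at_cap_dim C r.+1| * (2 * 3 ^ n * (3 ^ r.+1 - 1)))%N.
  rewrite big_distrr -sum_nat_const; apply: eq_bigr => D.
  by rewrite inE => /andP[sdD /eqP dimD]; rewrite /= card_isotropic_pairs ?dimD.
move: L R => /[swap] R /[swap] E; rewrite {}E => L.
have {R} := R; rewrite -[9%N]/(3 * 3)%N -mulnA {}L.
have -> : (3 ^ n = 3 ^ \dim C * 3 ^ \dim C)%N.
  by rewrite -expnD addnn -mul2n dim_self_dual.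
have : (0 < 3 ^ \dim C)%N by rewrite expn_gt0.
move: #|at_cap_dim C r| #|_| (3 ^ \dim C)%N (3 ^ r.+1 - 1)%N => N N' q b q0.
move: (q - 3 ^ r)%N => a h.
apply/eqP; rewrite -(eqn_pmul2l q0) -(eqn_pmul2l (ltn0Sn 1)); apply/eqP; lia.
Qed.

(** * The number of neighbors *)

Lemma at_cap_dim_max n (C : code n) : self_dual C ->
  at_cap_dim C (\dim C) = [set C].
Proof.
move=> sdC; apply/setP => D; rewrite !inE.
apply/andP/eqP => [[sdD /eqP dimCD]|->].
  have dimD := eq_dim_self_dual sdD sdC.
  have CD : (C :&: D)%VS = C by apply/eqP; rewrite eqEdim capvSl dimCD /=.
  by apply/esym/eqP; rewrite eqEdim dimD leqnn andbT -CD capvSr.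
by rewrite capvv.
Qed.

Theorem theorem3p13 (n : nat) (n_gt0 : (0 < n)%N) (n_mod4 : (4 %| n)%N)
    (C : code n) (C_III : type_III C)
    (k : nat) (k_gt0 : (0 < k)%N) (k_le : (k <= n./2)%N) :
  (nb_type_III_neighbors k C)%:R =
    (\prod_(0 <= i < k) (3 ^+ (n - 1 - i) - 3 ^+ (n./2 - 1)))
    / (\prod_(0 <= j < k) (3 ^+ n./2 - 3 ^+ (n./2 - 1 - j))) :> rat.
Proof.
have sdC : self_dual C by rewrite -type_IIIE.
have dimC := dim_self_dual sdC.
have m_def : n./2 = \dim C by lia.
have -> : nb_type_III_neighbors k C = #|at_cap_dim C (n./2 - k)|.
  by apply: eq_card => D; rewrite !inE type_IIIE.
rewrite -prodf_div.
elim: k k_le {k_gt0} => [_|k IHk k_lt].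
  by rewrite m_def subn0 at_cap_dim_max // cards1 big_geq.
rewrite big_nat_recr //= -IHk ?(ltnW k_lt) // m_def; rewrite m_def in k_lt.
have := card_at_cap_dim_rec (\dim C - k.+1) sdC.
rewrite -subSn // subSS.
have -> : (n - 1 - k = (\dim C - 1) + (\dim C - k))%N by lia.
have -> : (\dim C - 1 - k = \dim C - k.+1)%N by lia.
move/(congr1 (fun x => x%:R : rat)).
rewrite !natrM !natrB ?expn_gt0 ?leq_exp2l ?leq_subr // !natrX.
set N := #|_|%:R; set N' := #|_|%:R.
(* With [m = k + d + 1], all exponents become sums. *)
have [d dE] : exists d, \dim C = (k + d).+1.
  by exists (\dim C - k.+1)%N; lia.
rewrite {}dE.
have -> : ((k + d).+1 - 1 = k + d)%N by lia.
have -> : ((k + d).+1 - k.+1 = d)%N by lia.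
have -> : ((k + d).+1 - k = d.+1)%N by lia.
move=> h.
have d0 : 3 ^+ (k + d).+1 - 3 ^+ d != 0 :> rat.
  by rewrite subr_eq0 (inj_eq (ieexprIn _ _)) //; lia.
apply: (mulIf d0); rewrite -mulrA divfK //.
have three0 : 3 != 0 :> rat by [].
by apply: (mulfI three0); rewrite mulrA h exprD !exprS; ring.
Qed.
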